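(* Let $\mathbb{K}\in\{\mathbb{K}_c,\mathbb{K}_v,\mathbb{K}_o,\mathbb{K}_s,\mathbb{K}_d\}$, let $f,F_{1,i},F_{2,i}:\mathbb{R}^n\to\mathbb{R}$, $i=1,\ldots,m$, be twice continuously differentiable, let $M=\{x\in\mathbb{R}^n \mid (F_{1,i}(x),F_{2,i}(x))\in\mathbb{K},\ i=1,\ldots,m\}$, and let $\bar x\in M$ satisfy SNO-LICQ and $F_{1,i}(\bar x)=F_{2,i}(\bar x)=0$ for all $i=1,\ldots,m$. Suppose that $\bar x$ is an $N$-stationary point of the problem $\min_x f(x)$ s.t. $x\in M$. Then $\bar x$ is not $\widehat N$-stationary if and only if $\bar x$ is a singular saddle point of first order.
   Context: Cones in $\mathbb{R}^2$: $\mathbb{K}_c=\{(a_1,a_2)\mid a_1a_2=0,\ a_1\ge 0,\ a_2\ge 0\}$ (complementarity, MPCC); $\mathbb{K}_v=\{(a_1,a_2)\mid a_1\ge 0,\ a_1a_2\le 0\}$ (vanishing, MPVC); $\mathbb{K}_o=\{(a_1,a_2)\mid a_1a_2=0,\ a_2\ge 0\}$ (orthogonality type, MPOC); $\mathbb{K}_s=\{(a_1,a_2)\mid a_1a_2=0\}$ (switching, MPSC); $\mathbb{K}_d=\{(a_1,a_2)\mid a_1\ge 0\text{ or }a_2\ge 0\}$ (disjunctive, MPDC). The structured nonsmooth optimization problem SNO is: minimize $f(x)$ subject to $x\in M$. SNO-LICQ at $\bar x\in M$: the vectors $\nabla F_{1,i}(\bar x)$ for $i\in\{1,\ldots,m\}$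 with $F_{1,i}(\bar x)=0$, together with $\nabla F_{2,i}(\bar x)$ for $i\in\{1,\ldots,m\}$ with $F_{2,i}(\bar x)=0$, are linearly independent. Biactive index set: $I_{00}(\bar x)=\{i\in\{1,\ldots,m\}\mid F_{1,i}(\bar x)=0,\ F_{2,i}(\bar x)=0\}$; it is assumed throughout that $I_{00}(\bar x)=\{1,\ldots,m\}$. The tangential cone $T_M(\bar x)$ consists of all $w$ for which there exist $x^k\to\bar x$ with $x^k\in M$ and $\tau^k\searrow 0$ such that $(x^k-\bar x)/\tau^k\to w$. The Fréchet normal cone is $\widehat N_M(\bar x)=\{v\mid \langle v,w\rangle\le 0\text{ for all }w\in T_M(\bar x)\}$. The Mordukhovich (limiting) normal cone $N_M(\bar x)$ consists of all $v$ for which there exist $x^k\to\bar x$ with $x^k\in M$ and $v^k\in\widehat N_M(x^k)$ with $v^k\to v$. The point $\bar x\in M$ is called $\widehat N$-stationary if $0\in\nabla f(\bar x)+\widehat N_M(\bar x)$, and $N$-stationary if $0\in\nabla f(\bar x)+N_M(\bar x)$. The point $\bar x\in M$ is called T-stationary if there are multipliers $\lambda_{1,i},\lambda_{2,i}\in\mathbb{R}$, $i\in I_{00}(\bar x)$ (unique under SNO-LICQ), with $$\nabla f(\bar x)=\sum_{i\in I_{00}(\bar x)}\bigl(\lambda_{1,i}\nabla F_{1,i}(\bar x)+\lambda_{2,i}\nabla F_{2,i}(\bar x)\bigr)$$ such that for all $i\in I_{00}(\bar x)$: if $\mathbb{K}=\mathbb{K}_c$: $\lambda_{1,i}\lambda_{2,i}\ge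 0$; if $\mathbb{K}=\mathbb{K}_v$: $\lambda_{1,i}\lambda_{2,i}\ge 0$ and $\lambda_{2,i}\le 0$; if $\mathbb{K}=\mathbb{K}_o$: $\lambda_{1,i}=0$ or $\lambda_{2,i}\le 0$; if $\mathbb{K}=\mathbb{K}_s$: no restriction; if $\mathbb{K}=\mathbb{K}_d$: $\lambda_{1,i}\ge 0$ and $\lambda_{2,i}\ge 0$. A T-stationary point $\bar x\in M$ with multipliers $\lambda_{1,i},\lambda_{2,i}$ is called a saddle point of first order if for some $i\in I_{00}(\bar x)$ one has $(\lambda_{1,i},\lambda_{2,i})\ne(0,0)$ and, in addition: if $\mathbb{K}=\mathbb{K}_c$: $\lambda_{1,i}\le 0$ and $\lambda_{2,i}\le 0$; if $\mathbb{K}=\mathbb{K}_v$: $\lambda_{1,i}\le 0$ and $\lambda_{2,i}\le 0$; if $\mathbb{K}=\mathbb{K}_o$: $\lambda_{2,i}\le 0$; if $\mathbb{K}=\mathbb{K}_s$: no further restriction; if $\mathbb{K}=\mathbb{K}_d$: $\lambda_{1,i}\ge 0$ and $\lambda_{2,i}\ge 0$. A saddle point of first order $\bar x$ with multipliers $\lambda_{1,i},\lambda_{2,i}$, $i\in I_{00}(\bar x)$, is called singular if there exists $i\in I_{00}(\bar x)$ with either $\lambda_{1,i}=0$ or $\lambda_{2,i}=0$. *)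

(* Defs.v *)
From HB Require Import structures.
From mathcomp Require Import all_boot all_order all_algebra.
From mathcomp Require Import all_classical all_reals all_analysis.

Set Implicit Arguments.
Unset Strict Implicit.
Unset Printing Implicit Defensive.

Import Order.TTheory GRing.Theory Num.Theory.
Import numFieldNormedType.Exports.

Local Open Scope classical_set_scope.
Local Open Scope ring_scope.

Section Calculus.
Context {R : realType} {n : nat}.
Implicit Types (f : 'rV[R]_n -> R) (x v w : 'rV[R]_n).

Definition dotp v w : R := \sum_(j < n) v 0 j * w 0 j.

Definition grad f x : 'rV[R]_n := \row_(j < n) 'D_(delta_mx 0 j) f x.

(* The Jacobian of the gradient is the Hessian matrix of second partials. *)
Definition C2 f : Prop :=
  [/\ forall x, differentiable f x,
      forall x, differentiable (grad f) x
    & continuous (jacobian (grad f))].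

End Calculus.

Section Normals.
Context {R : realType} {n : nat}.
Implicit Types (M : set 'rV[R]_n) (f : 'rV[R]_n -> R) (x : 'rV[R]_n).

Definition tangent_cone M x : set 'rV[R]_n :=
  [set w | exists (x_ : nat -> 'rV[R]_n) (tau : nat -> R),
     [/\ forall k, M (x_ k),
         x_ @ \oo --> x,
         forall k, 0 < tau k,
         tau @ \oo --> 0
       & (fun k => (tau k)^-1 *: (x_ k - x)) @ \oo --> w]].

Definition frechet_normal M x : set 'rV[R]_n :=
  [set v | forall w, tangent_cone M x w -> dotp v w <= 0].

Definition limiting_normal M x : set 'rV[R]_n :=
  [set v | exists x_ v_ : nat -> 'rV[R]_n,
     [/\ forall k, M (x_ k),
         x_ @ \oo --> x,
         forall k, frechet_normal M (x_ k) (v_ k)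
       & v_ @ \oo --> v]].

Definition frechet_stationary f M x : Prop :=
  M x /\ [set grad f x + v | v in frechet_normal M x] 0.

Definition limiting_stationary f M x : Prop :=
  M x /\ [set grad f x + v | v in limiting_normal M x] 0.

End Normals.

Inductive cone_kind : Set :=
  Complementarity | Vanishing | Orthogonality | Switching | Disjunctive.

Definition cone (R : realType) (K : cone_kind) : set (R * R) :=
  match K with
  | Complementarity => [set a | [/\ a.1 * a.2 = 0, 0 <= a.1 & 0 <= a.2]]
  | Vanishing       => [set a | 0 <= a.1 /\ a.1 * a.2 <= 0]
  | Orthogonality   => [set a | a.1 * a.2 = 0 /\ 0 <= a.2]
  | Switching       => [set a | a.1 * a.2 = 0]
  | Disjunctive     => [set a | 0 <= a.1 \/ 0 <= a.2]
  end.

Section SNO.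
Context {R : realType} {n m : nat}.
Variables (K : cone_kind) (f : 'rV[R]_n -> R).
Variables (F1 F2 : 'I_m -> 'rV[R]_n -> R).
Implicit Types (x : 'rV[R]_n) (l : 'I_m -> R).

Definition feasible_set : set 'rV[R]_n :=
  [set x | forall i, cone K (F1 i x, F2 i x)].

(* [free] is applied to a list, so a repeated vector is linearly dependent. *)
Definition SNO_LICQ x : Prop :=
  free ([seq grad (F1 i) x | i <- enum 'I_m & F1 i x == 0] ++
        [seq grad (F2 i) x | i <- enum 'I_m & F2 i x == 0]).

Definition biactive x : pred 'I_m := fun i => (F1 i x == 0) && (F2 i x == 0).

Definition T_sign (a b : R) : Prop :=
  match K with
  | Complementarity => 0 <= a * b
  | Vanishing       => 0 <= a * b /\ b <= 0
  | Orthogonality   => a = 0 \/ b <= 0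
  | Switching       => True
  | Disjunctive     => 0 <= a /\ 0 <= b
  end.

Definition saddle_sign (a b : R) : Prop :=
  match K with
  | Complementarity => a <= 0 /\ b <= 0
  | Vanishing       => a <= 0 /\ b <= 0
  | Orthogonality   => b <= 0
  | Switching       => True
  | Disjunctive     => 0 <= a /\ 0 <= b
  end.

(* Multipliers at indices that are not biactive are irrelevant.  The three
   notions below are meant for points at which all indices are biactive: the
   gradients of other active constraints do not enter the representation. *)
Definition T_stationary_with x (l1 l2 : 'I_m -> R) : Prop :=
  [/\ feasible_set x,
      grad f x =
        \sum_(i < m | biactive x i)
          (l1 i *: grad (F1 i) x + l2 i *: grad (F2 i) x)
    & forall i, biactive x i -> T_sign (l1 i) (l2 i)].

Definition saddle_with x (l1 l2 : 'I_m -> R) : Prop :=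
  T_stationary_with x l1 l2 /\
  exists i, [/\ biactive x i, (l1 i, l2 i) <> (0, 0)
              & saddle_sign (l1 i) (l2 i)].

Definition singular_saddle x : Prop :=
  exists l1 l2, saddle_with x l1 l2 /\
    exists i, biactive x i /\ (l1 i = 0 \/ l2 i = 0).

End SNO.

(* Main.v *)
Require Import Defs.
From HB Require Import structures.
From mathcomp Require Import all_boot all_order all_algebra.
From mathcomp Require Import all_classical all_reals all_analysis.
From mathcomp Require Import ring lra.

(** Write G for the map whose components are all F1 i and F2 i, so that the
    feasible set M is the preimage under G of K^m, the m-fold product of the
    planar cone.  SNO-LICQ says that the derivative of G is onto at xbar, hence
    also at every point near xbar, and this makes M look like K^m to first
    order.

    The analytic core is [solve_first_order]: where the derivative of G is onto,
    each first-order motion of the value of G is realized exactly, by a point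
    close to the corresponding straight motion of the argument.  Exactness
    matters because K has empty interior in three of the five cases.  Hence a
    direction w is tangent to M at x as soon as the segment starting at G x in
    the direction of the derivative of G along w stays in K^m
    ([tangent_preimage]).  Testing a Frechet normal v against such w shows that
    v is a combination of the constraint gradients whose multiplier vector mu
    is normal to K^m at G x.  A left inverse of the Jacobian recovers mu
    from v continuously in x, so the multipliers converge along the sequences
    that define limiting normals ([limiting_normal_multiplier]).

    The rest takes place in the plane, one index i at a time, with
    lambda = - mu.
    At a limiting-stationary point each pair of mu lies in the limiting normal
    cone of K at the origin.  That gives the T-stationarity signs, and leaves
    two possibilities ([limiting_polar_or_saddle]): the pair lies in the polar
    of K, or it is nonzero with a vanishing component and its opposite has the
    saddle signs.  If every pair is polar, then, tangent directions of M being
    mapped into K^m ([tangent_cone_linearized]), xbar is Frechet stationary.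
    Otherwise xbar is a singular saddle point.

    Conversely, a nonzero multiplier pair with the saddle signs has a negative
    inner product with some vector of K ([saddle_descent]).  Since the gradients
    are independent, this vector placed at index i and zero elsewhere is the
    derivative of G along some w; this w is tangent to M and the derivative
    of f along it is negative, which excludes Frechet stationarity. *)

Set Implicit Arguments.
Unset Strict Implicit.
Unset Printing Implicit Defensive.

Import Order.TTheory GRing.Theory Num.Theory.
Import numFieldNormedType.Exports.

Local Open Scope classical_set_scope.
Local Open Scope ring_scope.

(** * Limits of matrices *)

Section MatrixLimits.
Context {R : realType} {T : Type} {F : set_system T}.
Context {FF : ProperFilter F}.

Lemma cvg_mxP (p q : nat) (A : T -> 'M[R]_(p, q)) (L : 'M[R]_(p, q)) :
  (forall i j, A t i j @[t --> F] --> L i j) -> A @ F --> L.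
Proof.
move=> AL S [P PL PS].
have : \forall t \near F, forall i j, P i j (A t i j).
  apply: (@filter_forall _ _ (fun i t => forall j, P i j (A t i j))) => i.
  apply: (@filter_forall _ _ (fun j t => P i j (A t i j))) => j.
  by have := AL i j _ (PL i j).
by apply: filterS => t Pt; exact: PS.
Qed.

Lemma cvg_mx_coord (p q : nat) (A : T -> 'M[R]_(p, q)) (L : 'M[R]_(p, q)) i j :
  A @ F --> L -> A t i j @[t --> F] --> L i j.
Proof.
move=> AL.
apply: (@continuous_cvg _ _ _ _ _ A (fun M : 'M[R]_(p, q) => M i j) L _ AL).
exact: coord_continuous.
Qed.

Lemma cvg_mulmx (p q r : nat) (A : T -> 'M[R]_(p, q)) (B : T -> 'M[R]_(q, r))
    (LA : 'M[R]_(p, q)) (LB : 'M[R]_(q, r)) :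
  A @ F --> LA -> B @ F --> LB -> (A t *m B t) @[t --> F] --> LA *m LB.
Proof.
move=> AL BL; apply: cvg_mxP => i j; rewrite mxE.
under eq_fun do rewrite mxE.
apply: cvg_big => [|k _]; first exact: add_continuous.
by apply: cvgM; exact: cvg_mx_coord.
Qed.

Lemma cvg_trmx (p q : nat) (A : T -> 'M[R]_(p, q)) (L : 'M[R]_(p, q)) :
  A @ F --> L -> (A t)^T @[t --> F] --> L^T.
Proof.
move=> AL; apply: cvg_mxP => i j; rewrite mxE.
by under eq_fun do rewrite mxE; exact: cvg_mx_coord.
Qed.

Lemma cvg_det (p : nat) (A : T -> 'M[R]_p) (L : 'M[R]_p) :
  A @ F --> L -> \det (A t) @[t --> F] --> \det L.
Proof.
move=> AL; rewrite /determinant.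
apply: cvg_big => [|s _]; first exact: add_continuous.
apply: cvgM; first exact: cvg_cst.
apply: cvg_big => [|i _]; first exact: mul_continuous.
exact: cvg_mx_coord.
Qed.

Lemma near_unitmx (p : nat) (A : T -> 'M[R]_p) (L : 'M[R]_p) :
  A @ F --> L -> L \in unitmx -> \forall t \near F, A t \in unitmx.
Proof.
move=> /cvg_det AL; rewrite unitmxE unitfE => L0.
near=> t; rewrite unitmxE unitfE; near: t.
exact: (cvgr_neq0 _ AL L0).
Unshelve. all: by end_near. Qed.

(** By Cramer's rule the inverse is a rational function of the entries. *)
Lemma cvg_invmx (p : nat) (A : T -> 'M[R]_p) (L : 'M[R]_p) :
  A @ F --> L -> L \in unitmx -> invmx (A t) @[t --> F] --> invmx L.
Proof.
move=> AL uL.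
have : ((\det (A t))^-1 *: \adj (A t)) @[t --> F] --> (\det L)^-1 *: \adj L.
  apply: cvg_mxP => i j; rewrite !mxE; under eq_fun do rewrite !mxE.
  apply: cvgM.
    by apply: cvgV; [move: uL; rewrite unitmxE unitfE | exact: cvg_det].
  apply: cvgM; first exact: cvg_cst.
  apply: cvg_det; apply: cvg_mxP => k l; rewrite !mxE.
  by under eq_fun do rewrite !mxE; exact: cvg_mx_coord.
rewrite /invmx uL; apply: cvg_trans.
apply: near_eq_cvg; near=> t.
have -> // : A t \in unitmx by near: t; exact: (near_unitmx AL uL).
Unshelve. all: by end_near. Qed.

End MatrixLimits.

Section RowVectors.
Context {R : realType} {n p : nat}.

Lemma compact_closed_ball0 (q : nat) (r : R) :
  compact [set u : 'rV[R]_q | `|u| <= r].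
Proof.
apply: bounded_closed_compact.
  exists r; split => [|s rs u /= /le_trans]; first exact: num_real.
  by apply; exact: ltW.
apply: (@closed_comp _ _ (fun u : 'rV[R]_q => `|u|) [set s : R | s <= r]).
  by move=> u _; exact: norm_continuous.
exact: closed_le.
Qed.

Lemma mulmxr_continuous (B : 'M[R]_(p, n)) :
  continuous (fun u : 'rV[R]_p => u *m B).
Proof.
move=> u; apply: (@cvg_mulmx _ _ (nbhs u)); first exact: cvg_id.
exact: cvg_cst.
Qed.

Lemma mulmxr_bounded (B : 'M[R]_(p, n)) :
  exists2 k : R, 0 < k & forall u : 'rV[R]_p, `|u *m B| <= k * `|u|.
Proof.
apply: (@linear_lipschitz R _ _ (mulmxr B)) => u.
exact: mulmxr_continuous.
Qed.

End RowVectors.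

(** * First-order solvability of equations *)

Section C1Map.
Context {R : realType} {n p : nat}.
Variable G : 'rV[R]_n -> 'rV[R]_p.
Hypothesis G_diff : forall x, differentiable G x.

Lemma diff_jacobianE x (h : 'rV[R]_n) : 'd G x h = h *m jacobian G x.
Proof. by rewrite /jacobian mul_rV_lin1. Qed.

Lemma first_order_remainder x e : 0 < e ->
  \forall h \near (0 : 'rV[R]_n),
    `|G (x + h) - G x - h *m jacobian G x| <= e * `|h|.
Proof.
move=> e0.
have := diff_locally (G_diff x).
move/eqaddoP => /(_ e e0).
apply: filterS => h /=.
by rewrite -diff_jacobianE !fctE /shift [h + x]addrC opprD addrA.
Qed.

(** One Newton step towards b, taken with a small length s, multiplies the
    residual by 1 - s up to an error that is o(s). *)
Lemma descent_direction y (b : 'rV[R]_p) (B : 'M[R]_(p, n)) :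
  B *m jacobian G y \in unitmx -> G y != b ->
  exists d : 'rV[R]_p, \forall s \near 0^'+,
    `|G (y + s *: (d *m B)) - b| < `|G y - b|.
Proof.
move=> uBJ Gyb; set z := G y - b.
have z0 : 0 < `|z| by rewrite normr_gt0 subr_eq0.
exists (- z *m invmx (B *m jacobian G y)).
set d := - z *m _.
have dJ : d *m B *m jacobian G y = - z.
  by rewrite -mulmxA /d mulmxKV.
set c := `|d *m B| + 1.
have c0 : 0 < c by rewrite ltr_wpDl.
have e0 : 0 < `|z| / (2 * c) by rewrite divr_gt0 // mulr_gt0.
have rem := first_order_remainder y e0.
have sh0 : (s *: (d *m B)) @[s --> 0^'+] --> (0 : 'rV[R]_n).
  rewrite -[X in _ --> X](scale0r (d *m B)).
  by apply: cvgZr_tmp; apply: cvg_at_right_filter; exact: cvg_id.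
near=> s.
have s0 : 0 < s by near: s; exact: nbhs_right_gt.
have s1 : s < 1 by near: s; exact: nbhs_right_lt.
have : `|G (y + s *: (d *m B)) - G y - (s *: (d *m B)) *m jacobian G y|
   <= `|z| / (2 * c) * `|s *: (d *m B)|.
  by near: s; exact: (sh0 _ rem).
rewrite -scalemxAl dJ normrZ (gtr0_norm s0) => r_le.
rewrite (_ : G _ - b = (1 - s) *: z +
   (G (y + s *: (d *m B)) - G y - s *: - z)); last first.
  by rewrite /z; apply/rowP => j; rewrite !mxE; ring.
apply: le_lt_trans (ler_normD _ _) _.
rewrite normrZ ger0_norm; last by rewrite subr_ge0 ltW.
apply: le_lt_trans (lerD (lexx _) r_le) _.
have -> : `|z| / (2 * c) * (s * `|d *m B|) = (s * `|z|) * (`|d *m B| / (2 * c)).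
  by ring.
have q1 : `|d *m B| / (2 * c) <= 1/2.
  rewrite ler_pdivrMr ?mulr_gt0 // /c; lra.
have sz0 : 0 < s * `|z| by rewrite mulr_gt0.
have := ler_wpM2l (ltW sz0) q1.
rewrite mulrBl mul1r; move: sz0; set a := s * `|z|; set q := a * (_ / _); lra.
Unshelve. all: by end_near. Qed.

End C1Map.

(** * Tangents and normals to a preimage *)

Section Tangents.
Context {R : realType} {n p : nat}.
Variable G : 'rV[R]_n -> 'rV[R]_p.
Hypothesis G_diff : forall x, differentiable G x.
Hypothesis G_C1 : continuous (jacobian G).

Lemma near_unit_jacobian x (B : 'M[R]_(p, n)) : B *m jacobian G x = 1%:M ->
  \forall y \near x, B *m jacobian G y \in unitmx.
Proof.
move=> BJ; apply: (@near_unitmx _ _ (nbhs x) _ p _ (B *m jacobian G x)).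
  by apply: cvg_mulmx; [exact: cvg_cst|exact: G_C1].
by rewrite BJ unitmx1.
Qed.

(** The point y is found as x + t w + u B, where u minimizes the residual
    over the ball of radius proportional to t.  On that ball the residual is u
    up to an error that is a small fraction of the radius, so the minimizer
    is interior; by [descent_direction] an interior minimizer has residual 0. *)
Lemma solve_first_order x (B : 'M[R]_(p, n)) w e :
  B *m jacobian G x = 1%:M -> 0 < e ->
  exists2 dlt, 0 < dlt & forall t, 0 < t < dlt -> exists2 y,
    `|y - (x + t *: w)| <= e * t & G y = G x + t *: (w *m jacobian G x).
Proof.
move=> BJ e0.
have [k k0 kB] := mulmxr_bounded B.
(* Every step t w + u B that occurs below has norm at most t N. *)
set N := `|w| + e.
have N0 : 0 < N by rewrite ltr_wpDl.
set r := e / k.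
have r0 : 0 < r by rewrite divr_gt0.
have eta0 : 0 < r / 3 / N by rewrite !divr_gt0.
have near_unit : \forall h \near (0 : 'rV[R]_n),
    B *m jacobian G (x + h) \in unitmx.
  by have /nbhs0P := near_unit_jacobian BJ.
have : \forall h \near (0 : 'rV[R]_n),
    `|G (x + h) - G x - h *m jacobian G x| <= r / 3 / N * `|h| /\
    B *m jacobian G (x + h) \in unitmx.
  by near=> h; split; near: h; first exact: first_order_remainder.
move=> /nbhs_norm0P[rho /= rho0 rhoP].
exists (rho / N); first exact: divr_gt0.
move=> t /andP[t0]; rewrite ltr_pdivlMr // => tN.
set b := G x + t *: (w *m jacobian G x).
pose Y (u : 'rV[R]_p) := x + t *: w + u *m B.
pose A := [set u : 'rV[R]_p | `|u| <= r * t].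
have stepP u : A u -> `|u *m B| <= e * t.
  move=> /= uA; apply: le_trans (kB u) _.
  by rewrite -ler_pdivlMl // mulrA [k^-1 * e]mulrC.
have YP u : A u -> `|t *: w + u *m B| <= t * N.
  move=> /stepP uB; apply: le_trans (ler_normD _ _) _.
  by rewrite normrZ gtr0_norm // mulrDr lerD // mulrC.
(* With error at most r t / 3, the residual at the minimizer is at most its
   value r t / 3 at 0, so the minimizer has norm at most 2 r t / 3. *)
have uE u : A u -> `|(G (Y u) - b) - u| <= r / 3 * t.
  move=> uA.
  have [rem _] := rhoP (t *: w + u *m B) (le_lt_trans (YP u uA) tN).
  rewrite (_ : _ - _ - u = G (x + (t *: w + u *m B)) - G x
     - (t *: w + u *m B) *m jacobian G x).
    apply: le_trans rem _; apply: le_trans (ler_wpM2l (ltW eta0) (YP u uA)) _.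
    by rewrite [t * N]mulrC mulrA divfK // gt_eqF.
  rewrite mulmxDl -mulmxA BJ mulmx1 -scalemxAl /b /Y addrA.
  by apply/rowP => j; rewrite !mxE; ring.
have A0 : A 0 by rewrite /A /= normr0 mulr_ge0 // ltW.
have cont : continuous (fun u => `|G (Y u) - b|).
  move=> u.
  have uB : (v *m B) @[v --> u] --> u *m B.
    exact: mulmxr_continuous.
  have Yu : Y v @[v --> u] --> Y u.
    exact: (cvgD (cvg_cst (x + t *: w)) uB).
  have GYu : G (Y v) @[v --> u] --> G (Y u).
    apply: (@continuous_cvg _ _ _ (nbhs u) _ Y G (Y u) _ Yu).
    exact: differentiable_continuous (G_diff (Y u)).
  exact: (cvg_norm (cvgB GYu (cvg_cst b))).
have [u uA umin] : exists2 u, u \in A &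
    forall v, v \in A -> `|G (Y u) - b| <= `|G (Y v) - b|.
  apply: EVT_min_rV; [by exists 0|exact: compact_closed_ball0|].
  exact: continuous_subspaceT.
rewrite inE in uA.
have u_int : `|u| < r * t.
  have h0 : `|G (Y 0) - b| <= r / 3 * t by have := uE 0 A0; rewrite subr0.
  have h1 : `|G (Y u) - b| <= r / 3 * t.
    by apply: le_trans h0; apply: umin; rewrite inE.
  have h2 : `|u| <= `|G (Y u) - b| + `|(G (Y u) - b) - u|.
    have := ler_normB (G (Y u) - b) ((G (Y u) - b) - u).
    by rewrite opprB addrC subrK.
  have h3 := uE u uA.
  have rt : 0 < r * t by rewrite mulr_gt0.
  move: h1 h2 h3; rewrite -[r / 3 * t]mulrA [3^-1 * t]mulrC mulrA; lra.
exists (Y u).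
  by rewrite /Y addrC addKr; exact: stepP.
apply/eqP; apply: contraT => Gb.
have uJ : B *m jacobian G (Y u) \in unitmx.
  by have [_] := rhoP _ (le_lt_trans (YP u uA) tN); rewrite addrA.
have [d dP] := descent_direction G_diff uJ Gb.
have shiftA : \forall s \near (0 : R)^'+, `|u + s *: d| < r * t.
  have usd : u + s *: d @[s --> (0 : R)^'+] --> u + 0 *: d.
    apply: (cvgD (cvg_cst u)).
    by apply: cvgZr_tmp; apply: cvg_at_right_filter; exact: cvg_id.
  rewrite scale0r addr0 in usd.
  by apply: cvgr_norm_lt u_int; exact: usd.
have [s [sd sA]] := filter_ex (filterI dP shiftA).
have := umin (u + s *: d); rewrite inE => /(_ (ltW sA)).
rewrite leNgt => /negP; case.
by rewrite {1}/Y mulmxDl addrA -scalemxAl; exact: sd.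
Unshelve. all: by end_near. Qed.

(** Feasible points within o(t) of x + t w, for all small t, yield the sequences
    in the definition of the tangent cone by a countable choice. *)
Lemma tangent_coneP (M : set 'rV[R]_n) x w :
  (forall e, 0 < e -> exists2 dlt, 0 < dlt & forall t, 0 < t < dlt ->
     exists2 y, M y & `|y - (x + t *: w)| <= e * t) ->
  tangent_cone M x w.
Proof.
move=> H.
have /choice[ty tyP] : forall k : nat, exists ty : R * 'rV[R]_n,
    [/\ M ty.2, 0 < ty.1, ty.1 <= k.+1%:R^-1 &
        `|ty.2 - (x + ty.1 *: w)| <= k.+1%:R^-1 * ty.1].
  move=> k; have k0 : 0 < k.+1%:R^-1 :> R by rewrite invr_gt0.
  have [dlt d0 dP] := H _ k0.
  pose t := Num.min (dlt / 2) k.+1%:R^-1.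
  have t0 : 0 < t by rewrite lt_min divr_gt0.
  have td : t < dlt by rewrite gt_min; apply/orP; left; lra.
  have [|y My yP] := dP t; first by rewrite t0.
  by exists (t, y); split => //=; rewrite ge_min lexx orbT.
have harm0 : (fun k : nat => k.+1%:R^-1 : R) @ \oo --> 0 by exact: cvg_harmonic.
have tau0 : (fun k => (ty k).1) @ \oo --> (0 : R).
  apply: (@squeeze_cvgr _ _ _ _ (cst 0) (fun k : nat => k.+1%:R^-1)) => //.
    by apply: nearW => k; have [_ /ltW ->] := tyP k.
  exact: cvg_cst.
have quot : (fun k => ((ty k).1)^-1 *: ((ty k).2 - x)) @ \oo --> w.
  apply/cvgrPdist_le => e e0.
  near=> k.
  have [_ t0 _ yP] := tyP k.
  rewrite distrC.
  rewrite (_ : _ - w = ((ty k).1)^-1 *: ((ty k).2 - (x + (ty k).1 *: w))).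
    rewrite normrZ gtr0_norm ?invr_gt0 // mulrC ler_pdivrMr //.
    apply: le_trans yP _; apply: ler_wpM2r; first exact: ltW.
    by apply: ltW; near: k; exact: (near_infty_natSinv_lt (PosNum e0)).
  by rewrite opprD addrA [in RHS]scalerBr scalerA mulVf ?scale1r // gt_eqF.
exists (fun k => (ty k).2), (fun k => (ty k).1); split => //.
- by move=> k; have [] := tyP k.
- have : ((fun k => (ty k).1 *: (((ty k).1)^-1 *: ((ty k).2 - x)) + x)) @ \oo
      --> 0 *: w + x.
    by apply: cvgD; [exact: cvgZ|exact: cvg_cst].
  rewrite scale0r add0r; apply: cvg_trans; apply: near_eq_cvg.
  apply: nearW => k; have [_ t0 _ _] := tyP k.
  by rewrite scalerA mulfV ?scale1r ?subrK // gt_eqF.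
- by move=> k; have [] := tyP k.
Unshelve. all: by end_near. Qed.

Lemma tangent_preimage (C : set 'rV[R]_p) x (B : 'M[R]_(p, n)) w :
  B *m jacobian G x = 1%:M ->
  (forall t, 0 < t < 1 -> C (G x + t *: (w *m jacobian G x))) ->
  tangent_cone (G @^-1` C) x w.
Proof.
move=> BJ Cd; apply: tangent_coneP => e e0.
have [dlt d0 dP] := solve_first_order w BJ e0.
exists (Num.min dlt 1); first by rewrite lt_min d0 ltr01.
move=> t /andP[t0]; rewrite lt_min => /andP[td t1].
have [|y yP Gy] := dP t; first by rewrite t0.
by exists y => //; rewrite /preimage /= Gy; apply: Cd; rewrite t0.
Qed.

End Tangents.

Section DotProduct.
Context {R : realType}.

Lemma dotp_mulmx (q : nat) (v w : 'rV[R]_q) : dotp v w = (v *m w^T) 0 0.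
Proof. by rewrite mxE; apply: eq_bigr => j _; rewrite mxE. Qed.

Lemma dotp_mulmxr (q r : nat) (A : 'M[R]_(q, r)) (v : 'rV[R]_r) (w : 'rV[R]_q) :
  dotp v (w *m A) = dotp (v *m A^T) w.
Proof. by rewrite !dotp_mulmx trmx_mul mulmxA. Qed.

Lemma dotp_delta (q : nat) (v : 'rV[R]_q) j : dotp v (delta_mx 0 j) = v 0 j.
Proof. by rewrite dotp_mulmx trmx_delta -colE mxE. Qed.

End DotProduct.

Section Normals.
Context {R : realType} {n p : nat}.
Variable G : 'rV[R]_n -> 'rV[R]_p.
Hypothesis G_diff : forall x, differentiable G x.
Hypothesis G_C1 : continuous (jacobian G).

(** Only directions along which C contains a whole segment are tested.  For
    the cones below these directions already determine the normal cone, and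
    they spare the tangent cone of C. *)
Definition segment_normal (C : set 'rV[R]_p) (a : 'rV[R]_p) : set 'rV[R]_p :=
  [set mu | forall d,
     (forall t, 0 < t < 1 -> C (a + t *: d)) -> dotp mu d <= 0].

(** A direction in the kernel of the Jacobian J does not move G to first order,
    so both it and its opposite are tangent and v is orthogonal to it; this puts
    v in the span of the gradients.  Any left inverse B of J reads the
    coefficients off, and d B is a direction that moves G along d. *)
Lemma frechet_normal_multiplier (C : set 'rV[R]_p) x (B : 'M[R]_(p, n)) v :
  B *m jacobian G x = 1%:M -> C (G x) ->
  frechet_normal (G @^-1` C) x v ->
  segment_normal C (G x) (v *m B^T) /\ v = v *m B^T *m (jacobian G x)^T.
Proof.
move=> BJ CGx vN; split.
  move=> d dC; rewrite -dotp_mulmxr; apply: vN.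
  apply: (tangent_preimage G_diff G_C1 BJ) => t.
  by rewrite -mulmxA BJ mulmx1; exact: dC.
have ker w : w *m jacobian G x = 0 -> dotp v w <= 0.
  move=> w0; apply: vN; apply: (tangent_preimage G_diff G_C1 BJ) => t _.
  by rewrite w0 scaler0 addr0.
apply/rowP => j.
pose e := delta_mx 0 j : 'rV[R]_n.
(* The projection of e to the kernel of the Jacobian along the range of B. *)
pose w := e - e *m jacobian G x *m B.
have w0 : w *m jacobian G x = 0.
  by rewrite /w mulmxBl -!mulmxA BJ mulmx1 subrr.
have vw : dotp v w = 0.
  apply/eqP; rewrite eq_le ker //=.
  have := ker (- w); rewrite mulNmx w0 oppr0 => /(_ erefl).
  by rewrite !dotp_mulmx linearN /= mulmxN mxE oppr_le0.
have := vw; rewrite dotp_mulmx /w linearB /= mulmxBr mxE [X in _ + X]mxE.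
rewrite -!dotp_mulmx dotp_mulmxr dotp_mulmxr !dotp_delta.
by move/eqP; rewrite subr_eq0 => /eqP.
Qed.

(** The closed set L stands for a closed condition on multipliers that holds at
    every point of C.  The left inverses B_k of the Jacobians at x_k are
    obtained by correcting a fixed left inverse B at x, so they tend to B and
    the multipliers of v_k converge. *)
Lemma limiting_normal_multiplier (C L : set 'rV[R]_p) x v :
  closed L -> (forall a, C a -> segment_normal C a `<=` L) ->
  row_full (jacobian G x) ->
  limiting_normal (G @^-1` C) x v ->
  exists2 mu, L mu & v = mu *m (jacobian G x)^T.
Proof.
move=> Lcl CL full [x_ [v_ [xM xx vN vv]]].
pose B := pinvmx (jacobian G x).
have BJ : B *m jacobian G x = 1%:M by exact: mulVpmx.
have Jx : jacobian G (x_ k) @[k --> \oo] --> jacobian G x.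
  by apply: (@continuous_cvg _ _ _ _ _ x_ (jacobian G) x _ xx); exact: G_C1.
have BJx : (B *m jacobian G (x_ k)) @[k --> \oo] --> (1%:M : 'M[R]_p).
  by rewrite -BJ; apply: cvg_mulmx; [exact: cvg_cst|exact: Jx].
have unit_k := near_unitmx BJx (unitmx1 R p).
pose B_ k := invmx (B *m jacobian G (x_ k)) *m B.
have BB : B_ @ \oo --> B.
  have := cvg_mulmx (cvg_invmx BJx (unitmx1 R p)) (cvg_cst B).
  by rewrite invmx1 mul1mx; apply.
have muB : (v_ k *m (B_ k)^T) @[k --> \oo] --> v *m B^T.
  by apply: cvg_mulmx; [exact: vv|apply: cvg_trmx; exact: BB].
have mult_k : \forall k \near \oo,
    segment_normal C (G (x_ k)) (v_ k *m (B_ k)^T)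
    /\ v_ k = v_ k *m (B_ k)^T *m (jacobian G (x_ k))^T.
  near=> k; apply: frechet_normal_multiplier; [|exact: xM|exact: vN].
  by rewrite /B_ -mulmxA mulVmx //; near: k; exact: unit_k.
exists (v *m B^T).
  apply: (closed_cvg L Lcl _ _ muB).
  apply: filterS mult_k => k [muN _].
  by apply: (CL (G (x_ k))) => //; exact: xM.
have vJ : (v_ k *m (B_ k)^T *m (jacobian G (x_ k))^T) @[k --> \oo]
    --> v *m B^T *m (jacobian G x)^T.
  by apply: cvg_mulmx; [exact: muB|apply: cvg_trmx; exact: Jx].
apply: (cvg_unique _ vv); first exact: norm_hausdorff.
apply: cvg_trans vJ; apply: near_eq_cvg.
by apply: filterS mult_k => k [_ <-].
Unshelve. all: by end_near. Qed.

(** The easy inclusion of the tangent cone in the linearized cone: the quotients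
    G (x_k) / tau_k stay in the closed cone C and tend to the derivative of G
    along w. *)
Lemma tangent_cone_linearized (C : set 'rV[R]_p) x w :
  closed C -> (forall s a, 0 < s -> C a -> C (s *: a)) -> G x = 0 ->
  tangent_cone (G @^-1` C) x w -> C (w *m jacobian G x).
Proof.
move=> Ccl Ccone Gx0 [x_ [tau [xM xx tau0 _ qw]]].
pose q k := (tau k)^-1 *: (x_ k - x).
have qJ : (q k *m jacobian G x) @[k --> \oo] --> w *m jacobian G x.
  by apply: cvg_mulmx; [exact: qw|exact: cvg_cst].
have rem0 : ((tau k)^-1 *: G (x_ k) - q k *m jacobian G x) @[k --> \oo]
    --> (0 : 'rV[R]_p).
  apply/cvgr0Pnorm_le => e e0.
  have c0 : 0 < `|w| + 1 by rewrite ltr_wpDl.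
  have eta0 : 0 < e / (`|w| + 1) by rewrite divr_gt0.
  have h0 : x_ k - x @[k --> \oo] --> (0 : 'rV[R]_n).
    by rewrite -(subrr x); exact: (cvgB xx (cvg_cst x)).
  have remk := h0 _ (first_order_remainder G_diff x eta0).
  have qbd : \forall k \near \oo, `|q k| < `|w| + 1.
    by apply: (@cvgr_norm_lt _ _ _ _ _ _ _ qw); rewrite ltrDl.
  near=> k.
  have tk := tau0 k.
  have : `|G (x + (x_ k - x)) - G x - (x_ k - x) *m jacobian G x|
      <= e / (`|w| + 1) * `|x_ k - x| by near: k; exact: remk.
  rewrite [x + _]addrC subrK Gx0 subr0 => r_le.
  rewrite /q -scalemxAl -scalerBr normrZ gtr0_norm ?invr_gt0 //.
  have qk : `|q k| < `|w| + 1 by near: k; exact: qbd.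
  apply: le_trans (ler_wpM2l _ r_le) _; first by rewrite invr_ge0 ltW.
  have -> : (tau k)^-1 * (e / (`|w| + 1) * `|x_ k - x|)
      = e / (`|w| + 1) * `|q k|.
    by rewrite /q normrZ gtr0_norm ?invr_gt0 // mulrCA.
  apply: le_trans (ler_wpM2l (ltW eta0) (ltW qk)) _.
  by rewrite divfK // gt_eqF.
have lim : ((tau k)^-1 *: G (x_ k)) @[k --> \oo] --> w *m jacobian G x.
  rewrite -[X in _ --> X]add0r.
  apply: cvg_trans (cvgD rem0 qJ); apply: near_eq_cvg.
  by apply: nearW => k; rewrite /= subrK.
apply: (@closed_cvg _ _ \oo _ (fun k => (tau k)^-1 *: G (x_ k)) C Ccl) lim.
by apply: nearW => k /=; apply: Ccone; [rewrite invr_gt0|exact: xM].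
Unshelve. all: by end_near. Qed.

End Normals.

(** * The five planar cones *)

Section ConeCalculus.
Context {R : realType}.
Implicit Types (K : cone_kind) (a d mu : R * R).

(** The limiting normal cone of each K at the origin.  In the complementarity
    case the two inequalities say that a component vanishes or both are
    negative; with absolute values this is visibly a closed condition. *)
Definition cone_limiting_normal K : set (R * R) :=
  match K with
  | Complementarity =>
      [set mu | mu.1 * `|mu.2| <= 0 /\ `|mu.1| * mu.2 <= 0]
  | Vanishing => [set mu | mu.1 * mu.2 = 0 /\ 0 <= mu.2]
  | Orthogonality | Switching => [set mu | mu.1 * mu.2 = 0]
  | Disjunctive => [set mu | [/\ mu.1 * mu.2 = 0, mu.1 <= 0 & mu.2 <= 0]]
  end.

Lemma cone_scale K s a : 0 <= s -> cone K a -> cone K (s * a.1, s * a.2).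
Proof.
move=> s0; case: a => a1 a2.
case: K => /= => [[p0 a1p a2p]|[a1p p0]|[p0 a2p]|p0|[a1p|a2p]].
- by split; [rewrite mulrACA p0 mulr0|exact: mulr_ge0|exact: mulr_ge0].
- by split; [exact: mulr_ge0|rewrite mulrACA mulr_ge0_le0 // mulr_ge0].
- by split; [rewrite mulrACA p0 mulr0|exact: mulr_ge0].
- by rewrite mulrACA p0 mulr0.
- by left; exact: mulr_ge0.
- by right; exact: mulr_ge0.
Qed.

Lemma cone0 K : @cone R K (0, 0).
Proof. by case: K => //=; rewrite ?mulr0; do ?split => //; left. Qed.

(** Near a boundary point other than the origin, K coincides with a line or a
    half-plane bounded by an axis, and at the origin K contains enough axis
    vectors; moves along the two axes thus settle all cases.  Where K
    continues on both sides of a along an axis, the corresponding component of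
    mu vanishes. *)
Lemma segment_normal_limiting K a mu : cone K a ->
  (forall d, (forall t, 0 < t < 1 -> cone K (a.1 + t * d.1, a.2 + t * d.2)) ->
     mu.1 * d.1 + mu.2 * d.2 <= 0) ->
  cone_limiting_normal K mu.
Proof.
case: a mu => a1 a2 [u v] Ka H.
have {}H (s1 s2 : R) := H (s1, s2).
rewrite /= in H.
have h1 (s : R) :
    (forall t, 0 < t < 1 -> cone K (a1 + t * s, a2)) -> u * s <= 0.
  move=> Hs; have := H s 0; rewrite !mulr0 addr0; apply=> t t01.
  by rewrite mulr0 addr0; exact: Hs.
have h2 (s : R) :
    (forall t, 0 < t < 1 -> cone K (a1, a2 + t * s)) -> v * s <= 0.
  move=> Hs; have := H 0 s; rewrite !mulr0 add0r; apply=> t t01.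
  by rewrite mulr0 addr0; exact: Hs.
have z1 (s : R) : s != 0 ->
    (forall t, -1 < t < 1 -> cone K (a1 + t * s, a2)) -> u = 0.
  move=> s0 Hs; apply/eqP; rewrite -[_ == _](mulIr_eq0 _ (mulIf s0)) eq_le.
  rewrite h1 => [|t]; last by move=> t01; apply: Hs; lra.
  rewrite -oppr_le0 -mulrN h1 // => t t01.
  by rewrite mulrN -mulNr; apply: Hs; lra.
have z2 (s : R) : s != 0 ->
    (forall t, -1 < t < 1 -> cone K (a1, a2 + t * s)) -> v = 0.
  move=> s0 Hs; apply/eqP; rewrite -[_ == _](mulIr_eq0 _ (mulIf s0)) eq_le.
  rewrite h2 => [|t]; last by move=> t01; apply: Hs; lra.
  rewrite -oppr_le0 -mulrN h2 // => t t01.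
  by rewrite mulrN -mulNr; apply: Hs; lra.
(* Steps proportional to the coordinate itself scale it by 1 + t, which keeps
   its sign. *)
clear H; case: K Ka h1 h2 z1 z2 => /= Ka h1 h2 z1 z2.
- case: Ka => /eqP; rewrite mulf_eq0 => p0 a1p a2p.
  have [a10|a1n] := eqVneq a1 0; last first.
    have a20 : a2 = 0 by move: p0; rewrite (negbTE a1n) => /eqP.
    rewrite (z1 a1) ?normr0 ?mul0r // => t t01.
    by rewrite a20 mulr0; split => //; nra.
  have [a20|a2n] := eqVneq a2 0; last first.
    rewrite (z2 a2) ?normr0 ?mulr0 // => t t01.
    by rewrite a10 mul0r; split => //; nra.
  have u0 : u * 1 <= 0.
    by apply: h1 => t t01; rewrite a10 a20 mulr0; split => //; lra.
  have v0 : v * 1 <= 0.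
    by apply: h2 => t t01; rewrite a10 a20 mul0r; split => //; lra.
  rewrite !mulr1 in u0 v0.
  by split; [exact: mulr_le0_ge0|exact: mulr_ge0_le0].
- case: Ka => a1p p0.
  have [a10|a1n] := eqVneq a1 0.
    rewrite (z2 1) ?oner_eq0 ?mulr0 //= => t t01.
    by rewrite a10 mul0r.
  have a1_gt0 : 0 < a1 by rewrite lt_def a1n.
  have a2n : a2 <= 0 by move: p0; rewrite pmulr_rle0.
  rewrite (z1 a1) // => [|t t01].
    rewrite mul0r; split => //.
    have : v * (-1) <= 0; last by lra.
    by apply: h2 => t t01; split => //; nra.
  by split; nra.
- case: Ka => /eqP; rewrite mulf_eq0 => p0 a2p.
  have [a20|a2n] := eqVneq a2 0.
    rewrite (z1 1) ?oner_eq0 ?mul0r //= => t t01.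
    by rewrite a20 mulr0.
  have a10 : a1 = 0 by move: p0; rewrite (negbTE a2n) orbF => /eqP.
  rewrite (z2 a2) ?mulr0 //= => t t01.
  by rewrite a10 mul0r; split => //; nra.
- have [a20|a2n] := eqVneq a2 0.
    rewrite (z1 1) ?oner_eq0 ?mul0r //= => t t01.
    by rewrite a20 mulr0.
  have a10 : a1 = 0.
    by apply/eqP; move/eqP: Ka; rewrite mulf_eq0 (negbTE a2n) orbF.
  rewrite (z2 1) ?oner_eq0 ?mulr0 //= => t t01.
  by rewrite a10 mul0r.
- case: Ka => ap.
    rewrite (z2 1) ?oner_eq0 ?mulr0 //=; last by move=> t _; left.
    split=> //; have : u * 1 <= 0; last by lra.
    by apply: h1 => t t01; left; lra.
  rewrite (z1 1) ?oner_eq0 ?mul0r //=; last by move=> t _; right.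
  split=> //; have : v * 1 <= 0; last by lra.
  by apply: h2 => t t01; right; lra.
Qed.

Lemma T_sign_limiting K mu :
  cone_limiting_normal K mu -> T_sign K (- mu.1) (- mu.2).
Proof.
case: mu => u v; case: K => /=.
- rewrite mulrNN => -[h1 h2].
  case: (ltrgtP v 0) h1 h2 => [v0|v0|-> _ _]; last by rewrite mulr0.
    by rewrite ltr0_norm // mulrN => h _; lra.
  case: (ltrgtP u 0) => [u0|u0|-> _ _]; last by rewrite mul0r.
    by rewrite gtr0_norm // ltr0_norm // mulNr => _ h; lra.
  by rewrite !gtr0_norm // => h _; have := mulr_gt0 u0 v0; lra.
- by rewrite mulrNN oppr_le0 => -[-> ->].
- by move=> /eqP; rewrite mulf_eq0 => /orP[] /eqP ->;
    rewrite oppr0; [left|right].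
- by [].
- by rewrite !oppr_ge0 => -[].
Qed.

(** The dichotomy behind the proposition: the limiting normals that are not
    Frechet normals of K at the origin are singular saddle pairs, up to sign. *)
Lemma limiting_polar_or_saddle K mu : cone_limiting_normal K mu ->
  (forall d, cone K d -> mu.1 * d.1 + mu.2 * d.2 <= 0) \/
  [/\ (- mu.1, - mu.2) <> (0, 0), saddle_sign K (- mu.1) (- mu.2)
    & - mu.1 = 0 \/ - mu.2 = 0].
Proof.
case: mu => u v.
have [->|u0] := eqVneq u 0.
  have [->|v0] := eqVneq v 0.
    by left => d _; rewrite /= !mul0r addr0.
  have ne : (- 0, - v) <> (0, 0) :> R * R.
    by case=> _ /eqP; rewrite oppr_eq0 (negbTE v0).
  case: K => /=.
  - move=> _; have [v1|v1] := leP v 0.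
      by left => d /= [_ _ d2]; rewrite mul0r add0r; exact: mulr_le0_ge0.
    by right; split => //; [split; lra|left; lra].
  - by move=> [_ v1]; right; split => //; [split; lra|left; lra].
  - move=> _; have [v1|v1] := leP v 0.
      by left => d /= [_ d2]; rewrite mul0r add0r; exact: mulr_le0_ge0.
    by right; split => //; [lra|left; lra].
  - by move=> _; right; split => //; left; lra.
  - by move=> [_ _ v1]; right; split => //; [split; lra|left; lra].
have uv0 : u * v = 0 -> v = 0.
  by move=> /eqP; rewrite mulf_eq0 (negbTE u0) => /eqP.
have ne w : (- u, w) <> (0, 0) :> R * R.
  by case=> /eqP; rewrite oppr_eq0 (negbTE u0).
case: K => /=.
- have [->|v0] := eqVneq v 0.
    move=> _; have [u1|u1] := leP u 0.
      by left => d /= [_ d1 _]; rewrite mul0r addr0; exact: mulr_le0_ge0.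
    by right; split => //; [split; lra|right; lra].
  rewrite pmulr_lle0 ?normr_gt0 // pmulr_rle0 ?normr_gt0 // => -[u1 v1].
  left => d /= [_ d1 d2].
  by have := mulr_le0_ge0 u1 d1; have := mulr_le0_ge0 v1 d2; lra.
- move=> [/uv0 -> _]; have [u1|u1] := leP u 0.
    by left => d /= [d1 _]; rewrite mul0r addr0; exact: mulr_le0_ge0.
  by right; split => //; [split; lra|right; lra].
- by move=> /uv0 ->; right; split; [exact: ne|lra|right; lra].
- by move=> /uv0 ->; right; split; [exact: ne|by []|right; lra].
- by move=> [/uv0 -> u1 _]; right; split; [exact: ne|split; lra|right; lra].
Qed.

(** An axis vector of K suffices, along an axis on which (a, b) is nonzero. *)
Lemma saddle_descent K (a b : R) : (a, b) <> (0, 0) -> saddle_sign K a b ->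
  exists2 d, cone K d & a * d.1 + b * d.2 < 0.
Proof.
move=> ne.
have nz : a != 0 \/ b != 0.
  have [a0|] := eqVneq a 0; last by left.
  have [b0|] := eqVneq b 0; last by right.
  by exfalso; apply: ne; rewrite a0 b0.
case: K => /=.
- move=> [a0 b0]; exists (if a == 0 then (0, 1) else (1, 0)).
    by case: ifP => _ /=; rewrite ?mulr0 ?mul0r; split => //; lra.
  case: ifPn => [a1|a1] /=.
    case: nz => [|b1]; first by rewrite a1.
    have : b < 0 by rewrite lt_neqAle b1.
    by lra.
  have : a < 0 by rewrite lt_neqAle a1.
  by lra.
- move=> [a0 b0]; exists (if a == 0 then (0, 1) else (1, 0)).
    by case: ifP => _ /=; rewrite ?mulr0 ?mul0r; split => //; lra.
  case: ifPn => [a1|a1] /=.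
    case: nz => [|b1]; first by rewrite a1.
    have : b < 0 by rewrite lt_neqAle b1.
    by lra.
  have : a < 0 by rewrite lt_neqAle a1.
  by lra.
- move=> b0; exists (if a == 0 then (0, 1) else (- a, 0)).
    by case: ifP => _ /=; rewrite ?mulr0 ?mul0r; split => //; lra.
  case: ifPn => [a1|a1] /=.
    case: nz => [|b1]; first by rewrite a1.
    have : b < 0 by rewrite lt_neqAle b1.
    by lra.
  have : 0 < a ^+ 2 by rewrite exprn_even_gt0.
  by rewrite expr2; lra.
- move=> _; exists (if a == 0 then (0, - b) else (- a, 0)).
    by case: ifP => _ /=; rewrite ?mulr0 ?mul0r.
  case: ifPn => [a1|a1] /=.
    case: nz => [|b1]; first by rewrite a1.
    have : 0 < b ^+ 2 by rewrite exprn_even_gt0.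
    by rewrite expr2; lra.
  have : 0 < a ^+ 2 by rewrite exprn_even_gt0.
  by rewrite expr2; lra.
- move=> [a0 b0]; exists (if a == 0 then (0, - 1) else (- 1, 0)).
    by case: ifP => _ /=; [left|right].
  case: ifPn => [a1|a1] /=.
    case: nz => [|b1]; first by rewrite a1.
    have : 0 < b by rewrite lt_def b1.
    by lra.
  have : 0 < a by rewrite lt_def a1.
  by lra.
Qed.

Lemma closed_eq0 (T : topologicalType) (g : T -> R) :
  continuous g -> closed [set x | g x = 0].
Proof.
move=> gc; apply: (@closed_comp _ _ g [set y : R | y = 0]).
  by move=> x _; exact: gc.
exact: closed_eq.
Qed.

Lemma closed_ge0 (T : topologicalType) (g : T -> R) :
  continuous g -> closed [set x | 0 <= g x].
Proof.
move=> gc; apply: (@closed_comp _ _ g [set y : R | 0 <= y]).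
  by move=> x _; exact: gc.
exact: closed_ge.
Qed.

Lemma closed_le0 (T : topologicalType) (g : T -> R) :
  continuous g -> closed [set x | g x <= 0].
Proof.
move=> gc; apply: (@closed_comp _ _ g [set y : R | y <= 0]).
  by move=> x _; exact: gc.
exact: closed_le.
Qed.

Let fst_cont : continuous (fun a : R * R => a.1).
Proof. by move=> a; exact: cvg_fst. Qed.
Let snd_cont : continuous (fun a : R * R => a.2).
Proof. by move=> a; exact: cvg_snd. Qed.
Let mul_cont : continuous (fun a : R * R => a.1 * a.2).
Proof. by move=> a; apply: cvgM; [exact: fst_cont|exact: snd_cont]. Qed.

Lemma closed_cone K : closed (cone K : set (R * R)).
Proof.
case: K => /=.
- rewrite (_ : [set _ | _] = [set a | a.1 * a.2 = 0] `&`
    ([set a | 0 <= a.1] `&` [set a | 0 <= a.2])); last first.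
    by apply/seteqP; split => a /=; [case|case=> ? []].
  apply: closedI; first exact: closed_eq0.
  by apply: closedI; exact: closed_ge0.
- by apply: closedI; [exact: closed_ge0|exact: closed_le0].
- by apply: closedI; [exact: closed_eq0|exact: closed_ge0].
- exact: closed_eq0.
- by apply: closedU; exact: closed_ge0.
Qed.

Lemma closed_cone_limiting_normal K : closed (cone_limiting_normal K).
Proof.
have n1 : continuous (fun a : R * R => a.1 * `|a.2|).
  by move=> a; apply: cvgM; [exact: fst_cont|apply: cvg_norm; exact: snd_cont].
have n2 : continuous (fun a : R * R => `|a.1| * a.2).
  by move=> a; apply: cvgM; [apply: cvg_norm; exact: fst_cont|exact: snd_cont].
case: K => /=.
- by apply: closedI; exact: closed_le0.
- by apply: closedI; [exact: closed_eq0|exact: closed_ge0].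
- exact: closed_eq0.
- exact: closed_eq0.
- rewrite (_ : [set _ | _] = [set a | a.1 * a.2 = 0] `&`
    ([set a | a.1 <= 0] `&` [set a | a.2 <= 0])); last first.
    by apply/seteqP; split => a /=; [case|case=> ? []].
  apply: closedI; first exact: closed_eq0.
  by apply: closedI; exact: closed_le0.
Qed.

End ConeCalculus.

(** * Assembling scalar constraints *)

Section RowMaps.
Context {R : realType} {n p : nat}.
Variable g : 'I_p -> 'rV[R]_n -> R.
Hypothesis g_diff : forall j x, differentiable (g j) x.

Definition row_map (x : 'rV[R]_n) : 'rV[R]_p := \row_j g j x.

Definition gradients (x : 'rV[R]_n) : 'M[R]_(n, p) :=
  \matrix_(i, j) grad (g j) x 0 i.

Lemma diff_grad (f : 'rV[R]_n -> R) x h :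
  differentiable f x -> 'd f x h = dotp (grad f x) h.
Proof.
move=> fx; rewrite [h in LHS]row_sum_delta linear_sum.
by apply: eq_bigr => i _; rewrite linearZ /= -deriveE // mxE mulrC.
Qed.

(** In the sup norm the remainder of the row is bounded by those of its
    finitely many components.  Continuity of the candidate differential and the
    expansion come together because they jointly characterize the
    differential. *)
Lemma row_map_differential x :
  continuous (mulmxr (gradients x) : 'rV[R]_n -> 'rV[R]_p) /\
  row_map \o shift x =
    cst (row_map x) + mulmxr (gradients x) +o_ (0 : 'rV[R]_n) id.
Proof.
split; first exact: mulmxr_continuous.
apply/eqaddoP => e e0.
have : \forall h \near (0 : 'rV[R]_n), forall j,
    `|(g j \o shift x - (cst (g j x) + 'd (g j) x)) h| <= e * `|id h|.
  apply: (@filter_forall _ _ (fun j h =>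
    `|(g j \o shift x - (cst (g j x) + 'd (g j) x)) h| <= e * `|id h|)
    (nbhs (0 : 'rV[R]_n)) _) => j.
  have := diff_locally (g_diff j x).
  by move/eqaddoP => /(_ e e0).
apply: filterS => h remh.
rewrite [X in X <= _]mx_normrE; apply/bigmax_leP; split.
  by apply: mulr_ge0; [exact: ltW|exact: normr_ge0].
move=> [i j] _ /=; rewrite ord1; apply: le_trans (remh j).
rewrite !mxE !fctE /= diff_grad //.
rewrite (_ : \sum_(_ < _) _ = dotp (grad (g j) x) h) //.
by apply: eq_bigr => k _; rewrite mxE mulrC.
Qed.

Lemma row_map_differentiable x : differentiable row_map x.
Proof.
have [c e] := row_map_differential x.
by apply/diff_locallyP; rewrite (diff_unique c e).
Qed.

Lemma jacobian_row_map x : jacobian row_map x = gradients x.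
Proof.
have [c e] := row_map_differential x.
rewrite /jacobian (diff_unique c e); apply/row_matrixP => i.
by rewrite !rowE mul_rV_lin1.
Qed.

Lemma gradients_continuous :
  (forall j, continuous (grad (g j))) -> continuous gradients.
Proof.
move=> gc x; apply: (@cvg_mxP _ _ (nbhs x)) => i j; rewrite mxE.
under eq_fun do rewrite mxE.
exact: (@cvg_mx_coord _ _ (nbhs x) _ _ _ _ _ _ _ (gc j x)).
Qed.

Lemma mulmx_gradientsT (mu : 'rV[R]_p) x :
  mu *m (gradients x)^T = \sum_j mu 0 j *: grad (g j) x.
Proof.
rewrite mulmx_sum_row; apply: eq_bigr => j _; congr (_ *: _).
by apply/rowP => i; rewrite !mxE.
Qed.

End RowMaps.

Section Pairs.
Context {R : realType} {m : nat}.

(** A row of length m + m carries the m planar points whose coordinates sit at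
    positions i and m + i. *)
Definition pairwise (P : set (R * R)) : set 'rV[R]_(m + m) :=
  [set a | forall i : 'I_m, P (a 0 (lshift m i), a 0 (rshift m i))].

Definition single_pair (i : 'I_m) (d : R * R) : 'rV[R]_(m + m) :=
  row_mx (d.1 *: delta_mx 0 i) (d.2 *: delta_mx 0 i).

Lemma single_pairE i d k :
  (single_pair i d 0 (lshift m k), single_pair i d 0 (rshift m k)) =
  if k == i then d else (0, 0).
Proof.
rewrite row_mxEl row_mxEr !mxE eqxx /=; case: ifP => _.
  by rewrite !mulr1 -surjective_pairing.
by rewrite !mulr0.
Qed.

Lemma dotp_pairs (v w : 'rV[R]_(m + m)) :
  dotp v w = \sum_(i < m) (v 0 (lshift m i) * w 0 (lshift m i) +
                           v 0 (rshift m i) * w 0 (rshift m i)).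
Proof. by rewrite /dotp big_split_ord /= big_split. Qed.

Lemma dotp_single_pair v i d :
  dotp v (single_pair i d) = v 0 (lshift m i) * d.1 + v 0 (rshift m i) * d.2.
Proof.
rewrite dotp_pairs (bigD1 i) //= big1 ?addr0 => [|k ki].
  have := single_pairE i d i; rewrite eqxx.
  by move=> /[dup] /(congr1 fst) /= -> /(congr1 snd) /= ->.
have := single_pairE i d k; rewrite (negbTE ki) => -[-> ->].
by rewrite !mulr0 addr0.
Qed.

Lemma closed_pairwise P : closed P -> closed (pairwise P).
Proof.
move=> Pcl.
rewrite (_ : pairwise P = \bigcap_(i in [set: 'I_m])
  ((fun a : 'rV[R]_(m + m) => (a 0 (lshift m i), a 0 (rshift m i))) @^-1` P)).
  apply: closed_bigI => i _; apply: closed_comp Pcl => a _.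
  have co j : b 0 j @[b --> a] --> a 0 j by exact: coord_continuous.
  exact: (cvg_pair (co (lshift m i)) (co (rshift m i))).
by apply/seteqP; split => a aP i; [move=> _|]; exact: aP.
Qed.

Lemma segment_normal_pairwise K a :
  pairwise (cone K) a ->
  segment_normal (pairwise (cone K)) a `<=` pairwise (cone_limiting_normal K).
Proof.
move=> aK mu muN i.
(* Moving the pair at index i alone keeps all other pairs in the cone. *)
apply: (segment_normal_limiting (aK i)) => d dK /=.
rewrite -dotp_single_pair; apply: muN => t t01 k.
have coordE j (w : 'rV[R]_(m + m)) : (a + t *: w) 0 j = a 0 j + t * w 0 j.
  by rewrite !mxE.
rewrite !coordE.
have := single_pairE i d k; case: eqP => [->|_].
  by move=> /[dup] /(congr1 fst) /= -> /(congr1 snd) /= ->; exact: dK.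
by case=> -> ->; rewrite mulr0 !addr0; exact: aK.
Qed.

End Pairs.

Section Problem.
Context {R : realType} {n m : nat}.
Variables (K : cone_kind) (F1 F2 : 'I_m -> 'rV[R]_n -> R).

Definition constraint (j : 'I_(m + m)) : 'rV[R]_n -> R :=
  match fintype.split j with inl i => F1 i | inr i => F2 i end.

Lemma constraint_lshift i : constraint (lshift m i) = F1 i.
Proof.
rewrite /constraint; case: split_ordP => k /eqP;
  by rewrite eq_shift // => /eqP ->.
Qed.

Lemma constraint_rshift i : constraint (rshift m i) = F2 i.
Proof.
rewrite /constraint; case: split_ordP => k /eqP;
  by rewrite eq_shift // => /eqP ->.
Qed.

Lemma feasible_setE :
  feasible_set K F1 F2 = row_map constraint @^-1` pairwise (cone K).
Proof.
apply/seteqP; split => x xM i; move: (xM i);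
by rewrite !mxE constraint_lshift constraint_rshift.
Qed.

Lemma multiplier_sum (mu : 'rV[R]_(m + m)) x :
  mu *m (gradients constraint x)^T =
  \sum_(i < m) (mu 0 (lshift m i) *: grad (F1 i) x +
                mu 0 (rshift m i) *: grad (F2 i) x).
Proof.
rewrite mulmx_gradientsT big_split_ord /= big_split /=.
by congr (_ + _); apply: eq_bigr => i _;
  rewrite (constraint_lshift, constraint_rshift).
Qed.

Lemma LICQ_row_full x : (forall i, F1 i x = 0) -> (forall i, F2 i x = 0) ->
  SNO_LICQ F1 F2 x -> row_full (gradients constraint x).
Proof.
move=> F10 F20; rewrite /SNO_LICQ.
have -> : [seq i <- enum 'I_m | F1 i x == 0] = enum 'I_m.
  by rewrite (eq_filter (a2 := predT)) ?filter_predT // => i; rewrite F10 eqxx.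
have -> : [seq i <- enum 'I_m | F2 i x == 0] = enum 'I_m.
  by rewrite (eq_filter (a2 := predT)) ?filter_predT // => i; rewrite F20 eqxx.
rewrite (_ : _ ++ _ = [tuple grad (constraint j) x | j < m + m]); last first.
  apply: (@eq_from_nth _ 0).
    by rewrite [RHS]size_tuple size_cat !size_map -enumT size_enum_ord.
  move=> k; rewrite size_cat !size_map -enumT size_enum_ord => km.
  have {km} [j ->] : exists j : 'I_(m + m), k = j by exists (Ordinal km).
  rewrite -tnth_nth tnth_mktuple nth_cat size_map size_enum_ord.
  case: (split_ordP j) => i -> /=.
    rewrite (nth_map i) ?size_enum_ord // constraint_lshift.
    by rewrite nth_ord_enum.
  rewrite addKn (nth_map i) ?size_enum_ord //.
  by rewrite constraint_rshift nth_ord_enum.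
move/freeP => indep.
suff: row_free (gradients constraint x)^T.
  by rewrite /row_free /row_full mxrank_tr.
apply: inj_row_free => mu; rewrite mulmx_gradientsT => mu0.
apply/rowP => j; rewrite mxE; apply: indep.
by rewrite -[RHS]mu0; apply: eq_bigr => k _; rewrite -tnth_nth tnth_mktuple.
Qed.

End Problem.

(** * The characterization *)

Unset Implicit Arguments.

Theorem proposition11 (R : realType) (n m : nat) (K : cone_kind)
    (f : 'rV[R]_n -> R) (F1 F2 : 'I_m -> 'rV[R]_n -> R) (xbar : 'rV[R]_n)
    (f_C2 : C2 f)
    (F1_C2 : forall i, C2 (F1 i))
    (F2_C2 : forall i, C2 (F2 i))
    (xbar_feasible : feasible_set K F1 F2 xbar)
    (licq : SNO_LICQ F1 F2 xbar)
    (F1_0 : forall i, F1 i xbar = 0)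
    (F2_0 : forall i, F2 i xbar = 0)
    (xbar_N : limiting_stationary f (feasible_set K F1 F2) xbar) :
  ~ frechet_stationary f (feasible_set K F1 F2) xbar
    <-> singular_saddle K f F1 F2 xbar.
Proof.
pose g := constraint F1 F2; pose G := row_map g.
have g_C2 j : C2 (g j) by rewrite /g /constraint; case: (fintype.split j).
have g_diff j x : differentiable (g j) x by have [] := g_C2 j.
have G_diff : forall x, differentiable G x by exact: row_map_differentiable.
have JE x : jacobian G x = gradients g x by exact: jacobian_row_map.
have G_C1 : continuous (jacobian G).
  rewrite (_ : jacobian G = gradients g); last by apply/funext.
  apply: gradients_continuous => j x; apply: differentiable_continuous.
  by have [] := g_C2 j.
have full : row_full (jacobian G xbar) by rewrite JE; exact: LICQ_row_full.
have G0 : G xbar = 0.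
  apply/rowP => j; rewrite !mxE /g /constraint.
  by case: (fintype.split j) => i; [exact: F1_0|exact: F2_0].
have act i : biactive F1 F2 xbar i by rewrite /biactive F1_0 F2_0 eqxx.
split=> [not_F|].
  have [_ [v vN /= fv]] := xbar_N.
  move: vN; rewrite feasible_setE => vN.
  have [mu muL vE] := limiting_normal_multiplier G_diff G_C1
    (closed_pairwise (@closed_cone_limiting_normal R K))
    (@segment_normal_pairwise R m K) full vN.
  pose l1 i := - mu 0 (lshift m i); pose l2 i := - mu 0 (rshift m i).
  have Tst : T_stationary_with K f F1 F2 xbar l1 l2.
    split=> [//||i _]; last exact: T_sign_limiting (muL i).
    rewrite (eq_bigl predT) //.
    have -> : grad f xbar = - v by apply/eqP; rewrite -addr_eq0 fv.
    rewrite vE JE multiplier_sum -sumrN; apply: eq_bigr => i _.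
    by rewrite opprD !scaleNr.
  have [[i isad]|no_saddle] := pselect (exists i,
      [/\ (l1 i, l2 i) <> (0, 0), saddle_sign K (l1 i) (l2 i)
        & l1 i = 0 \/ l2 i = 0]).
    have [ne sg z] := isad.
    exists l1, l2; split; last by exists i.
    by split => //; exists i.
  exfalso; apply: not_F; split => //=; exists v => // w.
  rewrite feasible_setE => wT.
  have wK : pairwise (cone K) (w *m jacobian G xbar).
    apply: (tangent_cone_linearized G_diff _ _ G0 wT).
      by apply: closed_pairwise; exact: closed_cone.
    by move=> s a s0 aK i; rewrite !mxE; exact: cone_scale (ltW s0) (aK i).
  rewrite vE -dotp_mulmxr dotp_pairs; apply: sumr_le0 => i _.
  have [pol|sad] := limiting_polar_or_saddle (muL i).
    exact: (pol _ (wK i)).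
  by exfalso; apply: no_saddle; exists i.
move=> [l1 [l2 [[[_ fE _] [i [_ ne sg]]] _]]] [_ [v vN /= fv]].
have [d dK dneg] := saddle_descent ne sg.
pose w := single_pair i d *m pinvmx (jacobian G xbar).
have BJ : pinvmx (jacobian G xbar) *m jacobian G xbar = 1%:M by exact: mulVpmx.
have wJ : w *m jacobian G xbar = single_pair i d by rewrite -mulmxA BJ mulmx1.
have wT : tangent_cone (feasible_set K F1 F2) xbar w.
  rewrite feasible_setE.
  apply: (tangent_preimage G_diff G_C1 BJ) => t /andP[t0 _] k.
  have coordE j (u : 'rV[R]_(m + m)) : (t *: u) 0 j = t * u 0 j by rewrite mxE.
  rewrite wJ G0 add0r !coordE.
  apply: (@cone_scale R K t (_, _) (ltW t0)); rewrite single_pairE.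
  by case: eqP => _; [exact: dK|exact: cone0].
pose mu := row_mx (\row_k - l1 k) (\row_k - l2 k) : 'rV[R]_(m + m).
have vE : v = mu *m (jacobian G xbar)^T.
  have -> : v = - grad f xbar by apply/eqP; rewrite -addr_eq0 addrC fv.
  rewrite fE (eq_bigl predT) // JE multiplier_sum -sumrN; apply: eq_bigr => k _.
  by rewrite opprD row_mxEl row_mxEr !mxE !scaleNr.
have := vN w wT; rewrite vE -dotp_mulmxr wJ dotp_single_pair.
rewrite row_mxEl row_mxEr !mxE; lra.
Qed.
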